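(* Let $G\in\mathcal{C}$, $N\unlhd G$, and $(H,H,\vartheta)\in\mathcal{L}_N$ of height $n$ with $i$-th node $(H_i,A_i,\vartheta_i)$, $1\le i\le n$. Let $K=\ker\vartheta$, $k=[H:K]$ and $\xi_k$ a primitive $k$-th root of unity. Then $\mathbb{Q}Ge_{\mathbb{Q}}(\vartheta^G)$ is isomorphic to $$M_{k_1}\Big(M_{k_2}\cdots\Big(M_{k_{n-1}}\big(\mathbb{Q}(\xi_k)\ast^{\sigma_{n-1}}_{\tau_{n-1}}N_{H_{n-1}}(K)/H\big)\ast^{\sigma_{n-2}}_{\tau_{n-2}}\cdots\Big)\ast^{\sigma_1}_{\tau_1}\operatorname{Cen}_{H_1}(e(H_2,H,K))/H_2\Big),$$ with $k_i,\sigma_i,\tau_i$ as described in the context.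
   Context: All groups are finite. $\mathcal{C}$ is the class of finite groups $G$ such that every subgroup and every quotient group of $G$ is either abelian or contains a non-central abelian normal subgroup. For $\chi\in\operatorname{Irr}M$, $e_{\mathbb{Q}}(\chi)=\frac{\chi(1)}{|M|}\sum_{\sigma\in\operatorname{Gal}(\mathbb{Q}(\chi)/\mathbb{Q})}\sum_{g\in M}\sigma(\chi(g))g^{-1}$. For $K\unlhd H\le M$: $\widehat H=\frac1{|H|}\sum_{h\in H}h$; $\varepsilon(H,K)=\widehat K$ if $H=K$, else $\prod(\widehat K-\widehat L)$ over $L\unlhd H$ with $L/K$ minimal normal in $H/K$; $e(M,H,K)$ = sum of distinct $M$-conjugates of $\varepsilon(H,K)$. $\psi^x(g)=\psi(xgx^{-1})$, $\psi^G$ induced character, $1_N$ trivial character. Fix $N\unlhd G$. An $N$-linear character triple is $(H,A,\vartheta)$ with $H\le G$, $A\unlhd H$, $\vartheta$ linear on $A$, invariant in $H$, $\ker(\vartheta^G)=N$. For $B\unlhd M\le G$, linear $\lambda$ on $B$, $\widetilde{\operatorname{Lin}}(M|\lambda)$ = linear characters of $M$ whose restriction to $B$ contains $\lambda$ and whose induction to $G$ has kernel $N$. For each triple a normal subgroup $\mathcal{A}=\mathcal{A}_{(H,A,\vartheta)}$ of $H$ is fixed, of maximal order among normal subgroups of $H$ containing $\ker\vartheta$ with abelian quotient by $\ker\vartheta$. $\operatorname{Aut}(\mathbb{C}|\vartheta)\times H$ acts on $\widetilde{\operatorname{Lin}}(\mathcal{A}|\vartheta)$ by $(\sigma,h)\cdot\varphi=\sigma\circ\varphi^h$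 ($\sigma$ a field automorphism of $\mathbb{C}$ fixing $\mathbb{Q}(\vartheta)$); fix orbit representatives $\mathfrak{Lin}(\mathcal{A}|\vartheta)$. If $H\ne A$, $Cl(H,A,\vartheta)=\{(I_H(\varphi),\mathcal{A},\varphi):\varphi\in\mathfrak{Lin}(\mathcal{A}|\vartheta)\}$, $I_H(\varphi)=\{h\in H:\varphi^h=\varphi\}$; if $H=A$, empty. $\mathcal{G}_N$: directed graph of $N$-linear triples reachable from $(G,N,1_N)$, edges $(u,v)$ when $v\in Cl(u)$; each vertex is reached by a unique directed path from the root. $\mathcal{L}_N$: vertices of the form $(H,H,\vartheta)$; for such a leaf with path $v_1=(G,N,1_N),\dots,v_n=(H,H,\vartheta)$, $n$ is its height and $v_i=(H_i,A_i,\vartheta_i)$ its $i$-th node. Crossed products: for a ring $R$, a group $Q$, an action $\sigma:Q\to\operatorname{Aut}(R)$ and twisting $\tau:Q\times Q\to\mathcal{U}(R)$, $R\ast^\sigma_\tau Q$ is the free $R$-module on $\{u_q:q\in Q\}$ with $u_q r=\sigma(q)(r)u_q$ and $u_qu_{q'}=\tau(q,q')u_{qq'}$. For $1\le i\le n-1$ let $C_i=\operatorname{Cen}_{H_i}(e(H_{i+1},H,K))$ $(=\operatorname{Cen}_{H_i}(e_{\mathbb{Q}}(\vartheta^{H_{i+1}})))$, so $C_{n-1}=N_{H_{n-1}}(K)$, and $k_i=[H_i:C_i]$. Fix representatives in $C_i$ of the cosets of $H_{i+1}$; $\sigma_i$ is the action of $C_i/H_{i+1}$ on $\mathbb{Q}H_{i+1}e_{\mathbb{Q}}(\vartheta^{H_{i+1}})$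 in which $\bar x$ acts by conjugation by its representative, and $\tau_i(\bar g_1,\bar g_2)=g\,e_{\mathbb{Q}}(\vartheta^{H_{i+1}})$ where $g\in H_{i+1}$ satisfies (rep. of $\bar g_1$)(rep. of $\bar g_2$) $=g\cdot$(rep. of $\bar g_1\bar g_2$). Here $\mathbb{Q}H_ne_{\mathbb{Q}}(\vartheta^{H_n})=\mathbb{Q}H\varepsilon(H,K)\cong\mathbb{Q}(\xi_k)$, and recursively $\mathbb{Q}H_ie_{\mathbb{Q}}(\vartheta^{H_i})$ is identified with $R_i=M_{k_i}(R_{i+1}\ast^{\sigma_i}_{\tau_i}C_i/H_{i+1})$ (with $R_n=\mathbb{Q}(\xi_k)$); $\sigma_i,\tau_i$ are transported to $R_{i+1}$ through this identification and denoted by the same symbols. *)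

(* Defs.v *)
From HB Require Import structures.
From mathcomp Require Import all_boot all_order all_algebra all_fingroup all_solvable all_field all_character.
From Stdlib Require Import ClassicalEpsilon.
Set Implicit Arguments. Unset Strict Implicit. Unset Printing Implicit Defensive.
Import Order.TTheory GRing.Theory Num.Theory.
Local Open Scope ring_scope.
Local Open Scope group_scope.

Section Defs.
Variable gT : finGroupType.

Definition Cprop (hT : finGroupType) (X : {set hT}) : bool :=
  abelian X ||
  [exists Y : {group hT}, [&& Y <| X, abelian Y & ~~ (Y \subset 'Z(X))]].

Definition classC (G : {group gT}) : Prop :=
  (forall H : {group gT}, H \subset G -> Cprop H) /\
  (forall M : {group gT}, M <| G -> Cprop (G / M)).

(* elements are finitely supported functions gT -> algC, i.e. sum_g a(g) g *)
Definition galg := {ffun gT -> algC}.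
Definition gel (g : gT) : galg := [ffun x => ((x == g) : nat)%:R].
Definition gmul (a b : galg) : galg :=
  [ffun x => (\sum_(y : gT) a y * b ((y^-1 * x)%g))%R].

Definition inQG (H : {set gT}) (a : galg) : bool :=
  [forall g, ((a g != 0) ==> (g \in H)) && (a g \in Crat)].
Definition QGe (H : {set gT}) (e : galg) : galg -> Prop :=
  fun x => exists2 a, inQG H a & x = gmul a e.

(* Galois conjugates of a class function: the sum over Gal(Q(chi)/Q) of
   sigma(chi(g)) is the sum over the distinct conjugates u o chi. We pick an
   enumeration (duplicate free) of these conjugates. *)
Definition is_conj_enum (M : {group gT}) (chi : 'CF(M)) (s : seq 'CF(M)) : Prop :=
  uniq s /\ forall psi, psi \in s <-> exists u : {rmorphism algC -> algC}, psi = cfAut u chi.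
Definition conjs (M : {group gT}) (chi : 'CF(M)) : seq 'CF(M) :=
  epsilon (inhabits [::]) (is_conj_enum chi).

Definition eQ (M : {group gT}) (chi : 'CF(M)) : galg :=
  [ffun x => (chi 1%g / (#|M|%:R) * \sum_(psi <- conjs chi) psi ((x^-1)%g))%R].

Definition iso_onto (P : galg -> Prop) (e : galg) (R : pzRingType) (f : galg -> R) : Prop :=
  [/\ forall x y, P x -> P y -> f (x + y)%R = (f x + f y)%R,
      forall x y, P x -> P y -> f (gmul x y) = (f x * f y)%R,
      f e = 1%R,
      forall x y, P x -> P y -> f x = f y -> x = y &
      forall r, exists2 x, P x & f x = r].

Definition iso_onto_sub (P : galg -> Prop) (e : galg) (F : algC -> Prop) (f : galg -> algC) : Prop :=
  [/\ forall x y, P x -> P y -> f (x + y)%R = (f x + f y)%R,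
      forall x y, P x -> P y -> f (gmul x y) = (f x * f y)%R,
      f e = 1%R,
      forall x y, P x -> P y -> f x = f y -> x = y &
      forall z, F z <-> exists2 x, P x & f x = z].

Definition Qadj (xi : algC) : algC -> Prop :=
  fun z => exists p : {poly rat}, z = (map_poly ratr p).[xi].

(* S is (a copy of) the crossed product  R *^sig_tau Q , where R is the
   subring P of CG with identity e: j embeds R, u_q are the basis elements. *)
Definition is_crossed_product (Hn : {set gT}) (S : nzRingType)
  (P : galg -> Prop) (e : galg) (Q : {set coset_of Hn})
  (sig : coset_of Hn -> galg -> galg) (tau : coset_of Hn -> coset_of Hn -> galg)
  (j : galg -> S) (u : coset_of Hn -> S) : Prop :=
  [/\ (forall x y, P x -> P y -> j (x + y)%R = (j x + j y)%R) /\
      (forall x y, P x -> P y -> j (gmul x y) = (j x * j y)%R),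
      j e = 1%R,
      (forall s : S, exists2 r : coset_of Hn -> galg,
          (forall q, q \in Q -> P (r q)) & s = (\sum_(q in Q) j (r q) * u q)%R) /\
      (forall r r' : coset_of Hn -> galg,
          (forall q, q \in Q -> P (r q)) -> (forall q, q \in Q -> P (r' q)) ->
          (\sum_(q in Q) j (r q) * u q)%R = (\sum_(q in Q) j (r' q) * u q)%R ->
          forall q, q \in Q -> r q = r' q),
      forall q x, q \in Q -> P x -> (u q * j x)%R = (j (sig q x) * u q)%R &
      forall q q', q \in Q -> q' \in Q -> (u q * u q')%R = (j (tau q q') * u ((q * q')%g))%R].

Record lintriple := LT { tH : {group gT}; tA : {group gT}; tth : 'CF(tA) }.

Variables G N : {group gT}.

Definition NLT (v : lintriple) : Prop :=
  [/\ tH v \subset G, tA v <| tH v, tth v \is a linear_char,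
      tH v \subset 'I[tth v] & cfker ('Ind[G] (tth v)) = N].

Definition LinT (M B : {group gT}) (lam : 'CF(B)) (phi : 'CF(M)) : Prop :=
  [/\ phi \is a linear_char, '['Res[B] phi, lam] != 0 & cfker ('Ind[G] phi) = N].

Definition in_orbit (H A M : {group gT}) (th : 'CF(A)) (phi r : 'CF(M)) : Prop :=
  exists u : {rmorphism algC -> algC},
    cfAut u th = th /\ exists2 h, h \in H & phi = cfAut u (r ^ h)%CF.

Definition calA_spec (v : lintriple) (X : {group gT}) : Prop :=
  let K := cfker (tth v) in
  [/\ X <| tH v, K \subset X, abelian (X / K) &
      forall Y : {group gT}, Y <| tH v -> K \subset Y -> abelian (Y / K) ->
        #|Y| <= #|X| ]%N.

Definition reps_spec (v : lintriple) (X : {group gT}) (R : 'CF(X) -> Prop) : Prop :=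
  (forall phi, R phi -> LinT (tth v) phi) /\
  (forall phi, LinT (tth v) phi ->
     exists! r, R r /\ in_orbit (tH v) (tth v) phi r).

Definition child (calA : lintriple -> {group gT})
  (reps : forall v, 'CF(calA v) -> Prop) (v w : lintriple) : Prop :=
  tH v != tA v /\
  exists2 phi : 'CF(calA v), reps v phi &
     w = @LT ('I_(tH v)[phi])%G (calA v) phi.

Definition root_triple : lintriple := @LT G N 1%R.

Definition leaf_path (calA : lintriple -> {group gT})
  (reps : forall v, 'CF(calA v) -> Prop) (p : seq lintriple) : Prop :=
  [/\ (0 < size p)%N,
      nth root_triple p 0 = root_triple,
      forall i, (i < size p)%N -> NLT (nth root_triple p i),
      forall i, (i.+1 < size p)%N ->
        child reps (nth root_triple p i) (nth root_triple p i.+1) &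
      tA (last root_triple p) = tH (last root_triple p)].

End Defs.

(* Main.v *)
Require Import Defs.
From HB Require Import structures.
From mathcomp Require Import all_boot all_order all_algebra all_fingroup all_solvable all_field all_character ring.
From Stdlib Require Import ClassicalEpsilon.
Set Implicit Arguments. Unset Strict Implicit. Unset Printing Implicit Defensive.
Import Order.TTheory GRing.Theory Num.Theory.
Local Open Scope ring_scope.

(* Write v = (L, B, nu) and w = (M, A, phi) for consecutive nodes of the path,
   so that A <| L, phi is a linear character of A and M = I_L(phi). By the
   maximality of A we have B <= A, so Clifford correspondence shows, going up
   from the leaf, that psi = Ind_M th and Ind_L psi are irreducible; moreover A
   acts on the primitive idempotents of the Galois conjugates of psi by scalars.
   Let e = e_Q(psi). If e h e <> 0 with h in L, comparing the scalars on both
   sides shows that phi^h is Galois conjugate to phi, hence that h normalizes M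
   and psi^h is Galois conjugate to psi, i.e. h centralizes e. So M is normal
   in C = Cen_L(e), the conjugates e^t (t in C\L) are orthogonal idempotents,
   and their sum is e_Q(Ind_L psi). Therefore Q L e_Q(Ind_L psi) is the ring of
   |L : C| x |L : C| matrices over e (Q L) e = Q C e, which is the crossed
   product of Q M e by C/M. At the leaf, x |-> sum_h x(h) th(h) identifies
   Q H e_Q(th) with Q(xi). *)

(** * The group algebra over [algC] and its rational elements *)

Section GroupAlgebra.
Variable gT : finGroupType.

(* A copy of [galg], whose default ring product would be the pointwise one.
   [gv] and [qidem] below are [gel] and [eQ] with values in this copy. *)
Definition galgr : Type := galg gT.
HB.instance Definition _ := GRing.Lmodule.copy galgr {ffun gT -> algC^o}.

Implicit Types (a b c : galgr) (g h x y : gT).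

Lemma gelE g x : gel g x = (x == g)%:R. Proof. by rewrite ffunE. Qed.

Lemma gmul_gell g a x : gmul (gel g) a x = a (g^-1 * x)%g.
Proof.
rewrite ffunE (bigD1 g) //= gelE eqxx mul1r big1 ?addr0 // => y /negPf yg.
by rewrite gelE yg mul0r.
Qed.

Lemma gmul_gelr g a x : gmul a (gel g) x = a (x * g^-1)%g.
Proof.
rewrite ffunE (bigD1 (x * g^-1)%g) //= gelE invMg invgK -mulgA mulVg mulg1 eqxx.
rewrite mulr1 big1 ?addr0 // => y; rewrite gelE => yg.
rewrite (_ : (_ == _) = false) ?mulr0 //; apply: contraNF yg => /eqP <-.
by rewrite invMg invgK mulKVg.
Qed.

Let gone : galgr := gel 1.

Lemma gmulA : associative (@gmul gT : galgr -> galgr -> galgr).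
Proof.
move=> a b c; apply/ffunP=> x; rewrite !ffunE.
under eq_bigr => y _ do rewrite ffunE big_distrr /=.
under [RHS]eq_bigr => y _ do rewrite ffunE big_distrl /=.
rewrite [RHS]exchange_big; apply: eq_bigr => y _ /=.
rewrite (reindex_inj (mulgI y^-1%g)) /=; apply: eq_bigr => z _.
by rewrite invMg invgK mulrA -!mulgA mulKVg.
Qed.

Lemma gmul1l : left_id gone (@gmul gT : galgr -> galgr -> galgr).
Proof. by move=> a; apply/ffunP=> x; rewrite gmul_gell invg1 mul1g. Qed.

Lemma gmul1r : right_id gone (@gmul gT : galgr -> galgr -> galgr).
Proof. by move=> a; apply/ffunP=> x; rewrite gmul_gelr invg1 mulg1. Qed.

Lemma gmulDl : left_distributive (@gmul gT : galgr -> galgr -> galgr) +%R.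
Proof.
move=> a b c; apply/ffunP=> x; rewrite !ffunE -big_split.
by apply: eq_bigr => y _; rewrite ffunE mulrDl.
Qed.

Lemma gmulDr : right_distributive (@gmul gT : galgr -> galgr -> galgr) +%R.
Proof.
move=> a b c; apply/ffunP=> x; rewrite !ffunE -big_split.
by apply: eq_bigr => y _; rewrite ffunE mulrDr.
Qed.

Lemma gone_neq0 : gone != 0.
Proof. by apply/eqP=> /ffunP/(_ 1%g)/eqP; rewrite gelE ffunE eqxx oner_eq0. Qed.

HB.instance Definition _ := GRing.Zmodule_isNzRing.Build galgr
  gmulA gmul1l gmul1r gmulDl gmulDr gone_neq0.

Lemma gscaleAl (k : algC) a b : k *: (a * b) = (k *: a) * b.
Proof.
apply/ffunP=> x; rewrite !ffunE /GRing.scale /= big_distrr; apply: eq_bigr => y _.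
by rewrite ffunE /GRing.scale /= mulrA.
Qed.
HB.instance Definition _ := GRing.Lmodule_isLalgebra.Build algC galgr gscaleAl.

Lemma gscaleAr (k : algC) a b : k *: (a * b) = a * (k *: b).
Proof.
apply/ffunP=> x; rewrite !ffunE /GRing.scale /= big_distrr; apply: eq_bigr => y _.
by rewrite ffunE /GRing.scale /= mulrCA.
Qed.
HB.instance Definition _ := GRing.Lalgebra_isAlgebra.Build algC galgr gscaleAr.

Definition gv g : galgr := gel g.

Lemma gmulE a b : gmul a b = a * b :> galgr. Proof. by []. Qed.

Lemma gv1 : gv 1 = 1. Proof. by []. Qed.

Lemma gv_mull g a x : (gv g * a) x = a (g^-1 * x)%g. Proof. exact: gmul_gell. Qed.
Lemma gv_mulr g a x : (a * gv g) x = a (x * g^-1)%g. Proof. exact: gmul_gelr. Qed.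

Lemma gvM g h : gv (g * h) = gv g * gv h.
Proof.
by apply/ffunP=> x; rewrite gv_mull !gelE -(inj_eq (mulgI g^-1%g)) mulKg.
Qed.

Lemma gvK g : gv g * gv g^-1%g = 1. Proof. by rewrite -gvM mulgV. Qed.
Lemma gvKV g : gv g^-1%g * gv g = 1. Proof. by rewrite -gvM mulVg. Qed.

Lemma galg_addE a b x : (a + b) x = a x + b x. Proof. by rewrite ffunE. Qed.
Lemma galg_sumE I (r : seq I) (P : pred I) (F : I -> galgr) x :
  (\sum_(i <- r | P i) F i) x = \sum_(i <- r | P i) F i x.
Proof. by elim/big_rec2: _ => [|i y z _ <-]; rewrite ffunE. Qed.
Lemma galg_scaleE (k : algC) a x : (k *: a) x = k * a x. Proof. by rewrite ffunE. Qed.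

Lemma galg_sum_gv a : a = \sum_g a g *: gv g.
Proof.
apply/ffunP=> x; rewrite galg_sumE (bigD1 x) //= galg_scaleE gelE eqxx mulr1 big1 ?addr0 //.
by move=> y; rewrite galg_scaleE gelE eq_sym => /negPf->; rewrite mulr0.
Qed.

Lemma inQGP (M : {set gT}) a :
  reflect ((forall g, g \notin M -> a g = 0) /\ (forall g, a g \in Crat)) (inQG M a).
Proof.
apply: (iffP forallP) => [Ma | [a0 aQ] g]; last first.
  by rewrite aQ andbT; apply/implyP; apply: contraR => /a0->.
split=> g; have /andP[/implyP a0 aQ] := Ma g => //.
by move=> Mg; apply/eqP; apply: contraNT Mg.
Qed.

Lemma inQG_sub (M L : {set gT}) a : M \subset L -> inQG M a -> inQG L a.
Proof.
move=> sML /inQGP[a0 aQ]; apply/inQGP; split=> // g Lg; apply: a0.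
by apply: contra Lg; apply: subsetP.
Qed.

Lemma inQG0 (M : {set gT}) : inQG M 0.
Proof. by apply/inQGP; split=> g; rewrite ffunE ?rpred0. Qed.

Lemma inQGD (M : {set gT}) a b : inQG M a -> inQG M b -> inQG M (a + b).
Proof.
move=> /inQGP[a0 aQ] /inQGP[b0 bQ]; apply/inQGP; split=> g.
  by move=> Mg; rewrite ffunE a0 ?b0 ?addr0.
by rewrite ffunE rpredD ?aQ ?bQ.
Qed.

Lemma inQGN (M : {set gT}) a : inQG M a -> inQG M (- a).
Proof.
move=> /inQGP[a0 aQ]; apply/inQGP; split=> g.
  by move=> Mg; rewrite ffunE a0 ?oppr0.
by rewrite ffunE rpredN aQ.
Qed.

Lemma inQG_sum (M : {set gT}) I (r : seq I) (P : pred I) (F : I -> galgr) :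
  (forall i, P i -> inQG M (F i)) -> inQG M (\sum_(i <- r | P i) F i).
Proof.
move=> MF; elim/big_rec: _ => [|i y /MF Fi yM]; first exact: inQG0.
exact: inQGD.
Qed.

Lemma inQGZ (M : {set gT}) k a : k \in Crat -> inQG M a -> inQG M (k *: a).
Proof.
move=> Qk /inQGP[a0 aQ]; apply/inQGP; split=> g; rewrite galg_scaleE.
  by move=> /a0->; rewrite mulr0.
by rewrite rpredM ?aQ.
Qed.

Lemma inQG_gv (M : {set gT}) g : g \in M -> inQG M (gv g).
Proof.
move=> Mg; apply/inQGP; split=> h; rewrite gelE ?rpred_nat //.
by case: eqP => // ->; rewrite Mg.
Qed.

Lemma inQGM (M : {group gT}) a b : inQG M a -> inQG M b -> inQG M (a * b).
Proof.
move=> /inQGP[a0 aQ] /inQGP[b0 bQ]; apply/inQGP; split=> g.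
  move=> Mg; rewrite -gmulE ffunE big1 // => y _.
  have [My | /a0->] := boolP (y \in M); last by rewrite mul0r.
  by rewrite b0 ?mulr0 // groupMl ?groupV.
by rewrite ffunE rpred_sum // => y _; rewrite rpredM ?aQ ?bQ.
Qed.

End GroupAlgebra.

(** * Galois conjugates of characters and their rational idempotents *)

Lemma char_fixed_Crat (gT : finGroupType) (M : {group gT}) (chi : 'CF(M)) x :
    chi \is a character ->
    (forall u : {rmorphism algC -> algC}, u (chi x) = chi x) ->
  chi x \in Crat.
Proof.
move=> Nchi fix_chi; have [Mx | /cfun0->] := boolP (x \in M); last exact: rpred0.
(* The values of [chi] lie in a Galois number field [Qn] whose automorphisms all extend to [algC]. A
   value fixed by every field automorphism thus lies in the fixed field of the Galois group, which
   is the prime field. *)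
have [Qn galQn [QnC autQn [w _ /(_ gT M chi Nchi x (order_dvdG Mx))[a Da]]]] :=
  group_num_field_exists M.
suffices /vlineP[k Dk] : a \in 1%VS.
  by rewrite -Da Dk rmorphZ_num rmorph1 mulr1 Crat_rat.
rewrite -(galois_fixedField galQn); apply/fixedFieldP=> [|nu galnu].
  exact: memvf.
have [u Du] := autQn nu.
by apply: (fmorph_inj QnC); rewrite Du /= Da fix_chi.
Qed.

Section RationalIdempotents.
Variable gT : finGroupType.
Implicit Types M L : {group gT}.

(** [conjs] is chosen by [epsilon], so some enumeration has to exist. Galois conjugates of an
    irreducible character are irreducible, hence filtering the duplicate-free list [irr M] gives
    one. *)
Lemma conjsP M (chi : 'CF(M)) : chi \in irr M -> is_conj_enum chi (conjs chi).
Proof.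
move=> irr_chi; apply: epsilon_spec.
pose galconj psi := exists u : {rmorphism algC -> algC}, psi = cfAut u chi.
pose b psi : bool := if excluded_middle_informative (galconj psi) then true else false.
exists [seq psi <- irr M | b psi]; split; first exact: filter_uniq (free_uniq (irr_free M)).
move=> psi; rewrite mem_filter /b; case: excluded_middle_informative => [[u Dpsi]|] //=.
by split=> _; [exists u | rewrite Dpsi cfAut_irr].
Qed.

Section Conj.
Variables (M : {group gT}) (chi : 'CF(M)).
Hypothesis irr_chi : chi \in irr M.

Lemma conjs_uniq : uniq (conjs chi). Proof. by have [] := conjsP irr_chi. Qed.

Lemma mem_conjs psi :
  psi \in conjs chi <-> exists u : {rmorphism algC -> algC}, psi = cfAut u chi.
Proof. by have [] := conjsP irr_chi. Qed.

Lemma conjs_id : chi \in conjs chi.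
Proof.
apply/mem_conjs; exists (idfun : {rmorphism algC -> algC}).
by apply/cfunP=> x; rewrite cfunE.
Qed.

Lemma conjs_irr psi : psi \in conjs chi -> psi \in irr M.
Proof. by case/mem_conjs=> u ->; rewrite cfAut_irr. Qed.

Lemma conjs1 psi : psi \in conjs chi -> psi 1%g = chi 1%g.
Proof. by case/mem_conjs=> u ->; rewrite cfAut_char1 ?irr_char ?irrWchar. Qed.

Lemma conjs_aut u psi : psi \in conjs chi -> cfAut u psi \in conjs chi.
Proof.
case/mem_conjs=> v ->; apply/mem_conjs; exists (u \o v).
by apply/cfunP=> x; rewrite !cfunE.
Qed.

Lemma conjs_autE u : perm_eq (map (cfAut u) (conjs chi)) (conjs chi).
Proof.
apply: uniq_perm; rewrite ?map_inj_uniq ?conjs_uniq //; first exact: cfAut_inj.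
move=> psi; apply/mapP/idP=> [[phi Cphi ->] | Cpsi]; first exact: conjs_aut.
exists (cfAut (algC_invaut u) psi); last by rewrite cfAutVK.
exact: conjs_aut.
Qed.

End Conj.

Lemma conjs_eq M (chi psi : 'CF(M)) : chi \in irr M -> psi \in conjs chi ->
  conjs psi =i conjs chi.
Proof.
move=> irr_chi Cpsi phi; have irr_psi := conjs_irr irr_chi Cpsi.
have /(mem_conjs irr_chi)[u Dpsi] := Cpsi.
apply/idP/idP=> [/(mem_conjs irr_psi)[v ->] | /(mem_conjs irr_chi)[v ->]].
  exact: conjs_aut.
apply/(mem_conjs irr_psi); exists (v \o algC_invaut u).
by apply/cfunP=> x; rewrite Dpsi !cfunE /= algC_autK.
Qed.

(** For irreducible [chi] this is the primitive central idempotent of the complex group algebra of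
    [M] that belongs to [chi]. *)
Definition cidem M (chi : 'CF(M)) : galgr gT :=
  [ffun x => chi 1%g / #|M|%:R * chi (x^-1)%g].

Lemma cidemE M (chi : 'CF(M)) x : cidem chi x = chi 1%g / #|M|%:R * chi (x^-1)%g.
Proof. by rewrite ffunE. Qed.

Definition qidem M (chi : 'CF(M)) : galgr gT := eQ chi.

(** Galois conjugates have the same degree, so the leading factor of [eQ] can be moved inside the
    sum. *)
Lemma qidemE M (chi : 'CF(M)) : chi \in irr M ->
  qidem chi = \sum_(psi <- conjs chi) cidem psi.
Proof.
move=> irr_chi; apply/ffunP=> x; rewrite galg_sumE ffunE big_distrr.
by rewrite !big_seq; apply: eq_bigr => psi Cpsi; rewrite cidemE (conjs1 irr_chi).
Qed.

(** A field automorphism permutes the conjugates of [chi], so their sum is a character fixed by all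
    automorphisms and its values are rational. *)
Lemma inQG_qidem M (chi : 'CF(M)) : chi \in irr M -> inQG M (qidem chi).
Proof.
move=> irr_chi; apply/inQGP; split=> x; rewrite ffunE.
  rewrite -groupV => Mx; rewrite big1 ?mulr0 // => psi _; exact: cfun0.
have Qchi1: chi 1%g \in Crat by rewrite rpred_nat_num ?Cnat_char1 ?irrWchar.
rewrite rpredM ?rpred_div ?rpred_nat //.
pose Th := \sum_(psi <- conjs chi) psi.
have ->: \sum_(psi <- conjs chi) psi (x^-1)%g = Th (x^-1)%g by rewrite sum_cfunE.
apply: char_fixed_Crat => [|u].
  by rewrite /Th big_seq rpred_sum // => psi /(conjs_irr irr_chi)/irrWchar.
suffices {2}<-: cfAut u Th = Th by rewrite [RHS]cfunE.
by rewrite raddf_sum -(big_map (cfAut u) xpredT id) (perm_big _ (conjs_autE irr_chi u)).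
Qed.

(** Coefficient by coefficient this is the generalized orthogonality relation. Only [y] in [M]
    contribute to the convolution, and the two factors in the argument of ['chi_j] may be swapped
    because it is a class function. *)
Lemma cidemM M (i j : Iirr M) :
  cidem 'chi_i * cidem 'chi_j = if i == j then cidem 'chi_i else 0.
Proof.
apply/ffunP=> x; rewrite -gmulE ffunE.
have ->: \sum_y cidem 'chi_i y * cidem 'chi_j (y^-1 * x)%g
   = 'chi_i 1%g * ('chi_j 1%g / #|M|%:R) * (#|M|%:R^-1 * \sum_(y in M) 'chi_j (y * x^-1)%g * 'chi_i y^-1%g).
  rewrite !big_distrr /= (bigID [in M]) /= addrC big1 => [|y My]; last first.
    by have /cfun0 y0: y^-1%g \notin M; rewrite ?groupV // cidemE y0 mulr0 mul0r.
  rewrite add0r; apply: eq_bigr => y My; rewrite !cidemE invMg invgK.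
  have <-: 'chi_j (x^-1 * y)%g = 'chi_j (y * x^-1)%g.
    by rewrite -(cfunJ 'chi_j (y * x^-1)%g My) conjgE mulgA mulKg.
  by set m := _^-1; ring.
rewrite generalized_orthogonality_relation eq_sym; case: eqP => [->|_].
  rewrite mul1r cidemE; have := irr1_neq0 j; have := neq0CG M.
  by set m := #|M|%:R => m0 j1; field; rewrite m0 j1.
by rewrite !mul0r mulr0 ffunE.
Qed.
End RationalIdempotents.

(** * Products and conjugates of the idempotents, and their commutation with group elements *)

Section CentralIdempotents.
Variable gT : finGroupType.
Implicit Types M L A : {group gT}.

Lemma cidem_irrM M (chi psi : 'CF(M)) : chi \in irr M -> psi \in irr M ->
  cidem chi * cidem psi = if chi == psi then cidem chi else 0.
Proof. by move=> /irrP[i ->] /irrP[j ->]; rewrite cidemM (inj_eq irr_inj). Qed.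

Lemma cidem_neq0 M (chi : 'CF(M)) : chi \in irr M -> cidem chi != 0.
Proof.
case/irrP=> i ->; apply/eqP=> /ffunP/(_ 1%g)/eqP; rewrite cidemE ffunE invg1.
by rewrite !mulf_eq0 invr_eq0 (negPf (irr1_neq0 i)) (negPf (neq0CG M)).
Qed.

Lemma qidem_cidem M (chi psi : 'CF(M)) : chi \in irr M -> psi \in irr M ->
  qidem chi * cidem psi = if psi \in conjs chi then cidem psi else 0.
Proof.
move=> irr_chi irr_psi; rewrite qidemE // big_distrl /= big_seq.
under eq_bigr => phi Cphi do rewrite cidem_irrM ?(conjs_irr irr_chi Cphi) //.
rewrite -big_seq -big_mkcond; case: ifP => Cpsi; last first.
  by rewrite big_seq_cond big1 // => phi /andP[Cphi /eqP Dphi]; rewrite -Dphi Cphi in Cpsi.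
rewrite -big_filter; have/(filter_pred1_uniq (conjs_uniq irr_chi)) := Cpsi.
by rewrite /= => ->; rewrite big_seq1.
Qed.

Lemma qidem_idem M (chi : 'CF(M)) : chi \in irr M -> qidem chi * qidem chi = qidem chi.
Proof.
move=> irr_chi; rewrite {2}qidemE // big_distrr /= [RHS]qidemE // !big_seq.
apply: eq_bigr => psi Cpsi; rewrite qidem_cidem ?Cpsi //.
exact: conjs_irr Cpsi.
Qed.

Lemma qidem_conjs M (chi psi : 'CF(M)) : chi \in irr M -> psi \in conjs chi ->
  qidem psi = qidem chi.
Proof.
move=> irr_chi Cpsi; have irr_psi := conjs_irr irr_chi Cpsi.
rewrite !qidemE //; apply: perm_big; apply: uniq_perm; rewrite ?conjs_uniq //.
exact: conjs_eq.
Qed.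

Lemma qidem_neq0 M (chi : 'CF(M)) : chi \in irr M -> qidem chi != 0.
Proof.
move=> irr_chi; apply: contraTneq (cidem_neq0 irr_chi) => e0.
by have:= qidem_cidem irr_chi irr_chi; rewrite conjs_id // e0 mul0r negbK => <-.
Qed.

Lemma gvJ_cidem M (chi : 'CF(M)) h : h \in 'N(M)%g ->
  gv h^-1%g * cidem chi * gv h = cidem (chi ^ h)%CF.
Proof.
move=> nMh; apply/ffunP=> x; rewrite gv_mulr gv_mull invgK !cidemE !cfConjgE //.
by rewrite conj1g conjVg conjgE invgK.
Qed.

(** Galois action on values and conjugation of arguments commute. *)
Lemma conjs_cfConjg M (chi : 'CF(M)) h : chi \in irr M -> h \in 'N(M)%g ->
  perm_eq (conjs (chi ^ h)%CF) [seq (psi ^ h)%CF | psi <- conjs chi].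
Proof.
move=> irr_chi nMh.
have irr_chih: (chi ^ h)%CF \in irr M.
  by have /irrP[i ->] := irr_chi; rewrite -conjg_IirrE mem_irr.
have cutJ u (psi : 'CF(M)) : cfAut u (psi ^ h)%CF = (cfAut u psi ^ h)%CF.
  by apply/cfunP=> x; rewrite !(cfConjgE, cfunE).
apply: uniq_perm; rewrite ?conjs_uniq ?map_inj_uniq ?conjs_uniq //.
  by move=> psi phi /(congr1 (cfConjg h^-1)); rewrite -!(cfConjgM _ (normalG M)) ?groupV // mulgV !cfConjgJ1.
move=> psi; apply/idP/mapP=> [/(mem_conjs irr_chih)[u ->] | [phi Cphi ->]].
  by exists (cfAut u chi); rewrite ?cutJ //; apply/(mem_conjs irr_chi); exists u.
have /(mem_conjs irr_chi)[u ->] := Cphi.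
by apply/(mem_conjs irr_chih); exists u; rewrite cutJ.
Qed.

Lemma gvJ_qidem M (chi : 'CF(M)) h : chi \in irr M -> h \in 'N(M)%g ->
  gv h^-1%g * qidem chi * gv h = qidem (chi ^ h)%CF.
Proof.
move=> irr_chi nMh.
have irr_chih: (chi ^ h)%CF \in irr M.
  by have /irrP[i ->] := irr_chi; rewrite -conjg_IirrE mem_irr.
rewrite !qidemE // big_distrr big_distrl (perm_big _ (conjs_cfConjg irr_chi nMh)) big_map.
by apply: eq_bigr => psi _; rewrite -gvJ_cidem.
Qed.

Lemma cidem_gvC M (chi : 'CF(M)) h : h \in M -> gv h * cidem chi = cidem chi * gv h.
Proof.
move=> Mh; rewrite -[in LHS](cfConjg_id chi Mh) -gvJ_cidem ?(subsetP (normG M)) //.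
by rewrite !mulrA gvK mul1r.
Qed.

Lemma qidem_gvC M (chi : 'CF(M)) h : chi \in irr M -> h \in M ->
  gv h * qidem chi = qidem chi * gv h.
Proof.
move=> irr_chi Mh; rewrite qidemE // big_distrr big_distrl.
by apply: eq_bigr => psi _; apply: cidem_gvC.
Qed.

Lemma inQG_comm (B : {set gT}) (e a : galgr gT) : (forall h, h \in B -> gv h * e = e * gv h) ->
  inQG B a -> a * e = e * a.
Proof.
move=> cMe /inQGP[a0 _]; rewrite [a]galg_sum_gv big_distrl big_distrr.
apply: eq_bigr => h _; rewrite /= -scalerAl -scalerAr.
by have [/cMe-> // | /a0->] := boolP (h \in B); rewrite !scale0r.
Qed.

Lemma qidem_comm M (chi : 'CF(M)) (a : galgr gT) : chi \in irr M -> inQG M a ->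
  a * qidem chi = qidem chi * a.
Proof. by move=> irr_chi; apply: inQG_comm => h; apply: qidem_gvC. Qed.

(** Trades the existential in [QGe] for two conditions that can be checked directly. Idempotence of
    [e] gives one direction; in the other, [x] is its own witness. *)
Lemma QGeP M (e x : galgr gT) : e * e = e -> inQG M e ->
  QGe M e x <-> inQG M x /\ x * e = x.
Proof.
move=> ee Me; split=> [[a Ma ->] | [Mx <-]]; last by exists x.
by split; [apply: inQGM | rewrite -[LHS]mulrA ee].
Qed.

(** For [g] in [A] the value [chi g] has absolute value [chi 1], so [g] lies in the center of [chi]
    and a representation affording [chi] sends it to a scalar. Evaluating [chi] at [g] identifies
    this scalar as [phi g]. *)
Lemma central_cidem A M (chi : 'CF(M)) (phi : 'CF(A)) g :
    chi \in irr M -> phi \is a linear_char -> A \subset M ->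
    'Res[A] chi = chi 1%g *: phi -> g \in A ->
  gv g * cidem chi = phi g *: cidem chi.
Proof.
move=> irr_chi lin_phi sAM resA Ag; have Mg := subsetP sAM g Ag.
have chi_g: chi g = chi 1%g * phi g by rewrite -(cfResE chi sAM Ag) resA cfunE.
suffices chigM x: x \in M -> chi (g * x)%g = phi g * chi x.
  apply/ffunP=> x; rewrite gv_mull galg_scaleE !cidemE mulrCA invMg invgK.
  have [Mx | notMx] := boolP (x \in M).
    by rewrite -chigM ?groupV // -(cfunJ chi (g * x^-1)%g Mg) conjgE !mulgA mulVg mul1g.
  have x'M: x^-1%g \notin M by rewrite groupV.
  have xg'M: (x^-1 * g)%g \notin M by rewrite groupMr.
  by rewrite (cfun0 chi x'M) (cfun0 chi xg'M) !mulr0.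
move=> Mx; have chi_1 : chi 1%g != 0 by have /irrP[i ->] := irr_chi; apply: irr1_neq0.
have Nchi := irrWchar irr_chi; have Zg : g \in 'Z(chi)%CF.
  rewrite /cfcenter Nchi inE Mg chi_g normrM (normC_lin_char lin_phi Ag) mulr1.
  by rewrite ger0_norm ?char1_ge0 ?eqxx.
case/char_reprP: Nchi => rG Dchi; rewrite Dchi cfcenter_repr in Zg.
case/setIdP: Zg => _ /is_scalar_mxP[c rGg].
have chig y: y \in M -> chi (g * y)%g = c * chi y.
  move=> My; rewrite Dchi !cfunE groupM // My repr_mxM // rGg mul_scalar_mx mxtraceZ.
  by rewrite !mulr1n.
rewrite chig //; congr (_ * _).
by have:= chig _ (group1 M); rewrite mulg1 chi_g mulrC => /(mulIf chi_1).
Qed.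

End CentralIdempotents.

(** * Elements that do not annihilate the idempotent of an inertia group *)

Section InertiaIdempotent.
Variables (gT : finGroupType) (L A : {group gT}) (phi : 'CF(A)).
Let M := 'I_L[phi]%G.
Variable psi : 'CF(M).
Hypotheses (nsAL : (A <| L)%g) (lin_phi : phi \is a linear_char).
Hypotheses (irr_psi : psi \in irr M) (resA : 'Res[A] psi = psi 1%g *: phi).
Let e := qidem psi.

Lemma sub_Inertia_base : A \subset M.
Proof. by rewrite subsetI (normal_sub nsAL) sub_inertia. Qed.

(** Applying [u] to [resA] shows that [cfAut u psi] restricts to a multiple of the linear character
    [cfAut u phi], so [central_cidem] applies to it. *)
Lemma conjs_central psi1 : psi1 \in conjs psi -> exists u : {rmorphism algC -> algC},
  forall g, g \in A -> gv g * cidem psi1 = u (phi g) *: cidem psi1.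
Proof.
move=> Cpsi1; have /(mem_conjs irr_psi)[u Dpsi1] := Cpsi1.
exists u => g Ag; have <-: cfAut u phi g = u (phi g) by rewrite cfunE.
apply: central_cidem (conjs_irr irr_psi Cpsi1) _ sub_Inertia_base _ Ag.
  by rewrite cfAut_lin_char.
rewrite (conjs1 irr_psi Cpsi1) Dpsi1 -cfAutRes resA cfAutZ_Cnat //.
by rewrite Cnat_char1 ?irrWchar.
Qed.

(* A nonzero [e h e] contains a nonzero [cidem psi1 * h * cidem psi2] with
   Galois conjugates [psi1], [psi2] of [psi]; the scalars by which [A] acts
   on both sides must agree, so [phi ^ h] is Galois conjugate to [phi]. *)
Lemma qidem_stab h : h \in L -> e * gv h * e != 0 ->
  h \in 'N(M)%g /\ gv h * e = e * gv h.
Proof.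
move=> Lh; have nAh := subsetP (normal_norm nsAL) h Lh.
rewrite /e {1 2}qidemE // big_distrl big_distrl /= => nz.
have [psi1 [Cpsi1 [psi2 Cpsi2 nz12]]] : exists psi1, psi1 \in conjs psi /\
    exists2 psi2, psi2 \in conjs psi & cidem psi1 * gv h * cidem psi2 != 0.
  have [/hasP[p1 C1 /hasP[p2 C2 nz12]] | /hasPn all0] := boolP (has (fun p1 =>
      has (fun p2 => cidem p1 * gv h * cidem p2 != 0) (conjs psi)) (conjs psi)).
    by exists p1; split=> //; exists p2.
  case/eqP: nz; rewrite big_seq big1 // => p1 /all0/hasPn all0p1.
  by rewrite big_distrr big_seq big1 // => p2 /all0p1/negPn/eqP.
have [s act1] := conjs_central Cpsi1; have [t act2] := conjs_central Cpsi2.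
have [irr1 irr2] := (conjs_irr irr_psi Cpsi1, conjs_irr irr_psi Cpsi2).
have sAM := sub_Inertia_base.
have phi_h g : g \in A -> s (phi g) = t (phi (g ^ h)%g).
  move=> Ag; have Agh: (g ^ h)%g \in A by rewrite memJ_norm.
  have: s (phi g) *: (cidem psi1 * gv h * cidem psi2) =
        t (phi (g ^ h)%g) *: (cidem psi1 * gv h * cidem psi2).
    rewrite [RHS]scalerAr -act2 // !scalerAl -act1 // cidem_gvC ?(subsetP sAM) //.
    by rewrite -!mulrA; congr (_ * _); rewrite !mulrA -!gvM conjgC.
  by move/eqP; rewrite -subr_eq0 -scalerBl scaler_eq0 (negPf nz12) orbF subr_eq0 => /eqP.
(* For [x] in [M], invariance of [phi] under [x ^ h] is tested after applying the injective map [t].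
   There [phi_h] carries it back to invariance under [x]. *)
have nMh : h \in 'N(M)%g.
  rewrite inE; apply/subsetP=> _ /imsetP[x Mx ->].
  have /setIP[Lx Ix] := Mx; have nAx := subsetP (norm_inertia _) x Ix.
  rewrite inE groupJ // inE; have nAxh : (x ^ h)%g \in 'N(A)%g by rewrite groupJ.
  rewrite nAxh; apply/eqP/cfun_inP=> y Ay; rewrite cfConjgE //.
  have Ay1: (y ^ (x ^ h)^-1)%g \in A by rewrite memJ_norm ?groupV.
  set z := ((y ^ (x ^ h)^-1) ^ h^-1)%g.
  have Az: z \in A by rewrite memJ_norm ?groupV.
  have <-: (z ^ h)%g = (y ^ (x ^ h)^-1)%g by rewrite conjgKV.
  apply: (fmorph_inj t); rewrite -phi_h //.
  have ->: y = ((z ^ x) ^ h)%g.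
    by rewrite -[y](conjgKV (x ^ h)%g) -conjVg -[(y ^ _)%g](conjgKV h) conjVg -/z -conjJg.
  have Azx: (z ^ x)%g \in A by rewrite (memJ_norm _ nAx).
  by rewrite -phi_h // (inertia_valJ z Ix).
have h'nM : h^-1%g \in 'N(M)%g by rewrite groupV.
have qJ p : p \in irr M -> gv h * qidem p = qidem (p ^ h^-1)%CF * gv h.
  by move=> irr_p; rewrite -gvJ_qidem // invgK -!mulrA gvKV mulr1.
split=> //; rewrite -(qidem_conjs irr_psi Cpsi2) qJ //; congr (_ * _).
have irr2h: (psi2 ^ h^-1)%CF \in irr M.
  by have /irrP[i ->] := irr2; rewrite -conjg_IirrE mem_irr.
(* Moving [h] to the right turns the nonzero product into one containing
   [cidem psi1 * cidem (psi2 ^ h^-1)]. Orthogonality forces the two characters to be equal, and all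
   conjugates of [psi] share one [qidem]. *)
suffices <-: psi1 = (psi2 ^ h^-1)%CF by rewrite !(qidem_conjs irr_psi).
apply: contraNeq nz12 => neq12.
have qJ2: gv h * cidem psi2 = cidem (psi2 ^ h^-1)%CF * gv h.
  by rewrite -gvJ_cidem // invgK -!mulrA gvKV mulr1.
by rewrite -mulrA qJ2 mulrA cidem_irrM // (negPf neq12) mul0r.
Qed.
End InertiaIdempotent.

(** * Corner rings and matrix rings over them *)

Lemma corner_nzRing (R : nzRingType) (P : {pred R}) (e : R) :
    (forall x y, x \in P -> y \in P -> x - y \in P) ->
    (forall x y, x \in P -> y \in P -> x * y \in P) ->
    e \in P -> e != 0 ->
    (forall x, x \in P -> e * x = x) -> (forall x, x \in P -> x * e = x) ->
  exists (S : nzRingType) (v : S -> R) (j : R -> S),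
    [/\ injective v, forall s, v s \in P, forall x, x \in P -> v (j x) = x &
     [/\ forall s t, v (s + t) = v s + v t, forall s t, v (s * t) = v s * v t
       & v 1 = e]].
Proof.
move=> PB PM Pe e0 eP Pe1.
have P0 : 0 \in P by rewrite -(subrr e) PB.
have PN x : x \in P -> - x \in P by move=> Px; rewrite -sub0r PB.
have PD x y : x \in P -> y \in P -> x + y \in P.
  by move=> Px Py; rewrite -[y]opprK PB ?PN.
(* The identity of the corner is [e] and not that of [R], so the corner gets a ring structure of its
   own, with [v] as inclusion into [R] and [j] as inverse of [v] on [P]. *)
pose T := {x : R | x \in P}.
pose zeroT : T := exist _ 0 P0; pose oneT : T := exist _ e Pe.
pose oppT (x : T) : T := exist _ (- sval x) (PN _ (svalP x)).
pose addT (x y : T) : T := exist _ (sval x + sval y) (PD _ _ (svalP x) (svalP y)).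
pose mulT (x y : T) : T := exist _ (sval x * sval y) (PM _ _ (svalP x) (svalP y)).
have addA : associative addT by move=> x y z; apply: val_inj; apply: addrA.
have addC : commutative addT by move=> x y; apply: val_inj; apply: addrC.
have add0 : left_id zeroT addT by move=> x; apply: val_inj; apply: add0r.
have addN : left_inverse zeroT oppT addT by move=> x; apply: val_inj; apply: addNr.
pose Z : zmodType := HB.pack T (GRing.isZmodule.Build T addA addC add0 addN).
have mulA : associative (mulT : Z -> Z -> Z) by move=> x y z; apply: val_inj; apply: mulrA.
have mul1l : left_id (oneT : Z) mulT by move=> x; apply: val_inj; apply: eP (svalP x).
have mul1r : right_id (oneT : Z) mulT by move=> x; apply: val_inj; apply: Pe1 (svalP x).
have mulDl : left_distributive (mulT : Z -> Z -> Z) +%R.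
  by move=> x y z; apply: val_inj; apply: mulrDl.
have mulDr : right_distributive (mulT : Z -> Z -> Z) +%R.
  by move=> x y z; apply: val_inj; apply: mulrDr.
have oneT0 : (oneT : Z) != 0 by apply: contraNneq e0 => /(congr1 val)/= ->.
pose S : nzRingType := HB.pack (Z : Type) Z
  (GRing.Zmodule_isNzRing.Build Z mulA mul1l mul1r mulDl mulDr oneT0).
(* Outside [P] the map [j] takes the default value zero. *)
exists S, (fun s : S => sval (s : T)), (fun x => insubd zeroT x).
split=> [||x Px|]; [exact: val_inj | exact: svalP | | by []].
exact: (@insubdK _ _ T zeroT x Px).
Qed.

(* [b s * a s] are orthogonal idempotents with sum [E], all equivalent to [e]. *)
Lemma matrix_corner (R S : nzRingType) (P : R -> Prop) (Q : {pred R}) (e E : R)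
    (v : S -> R) (j : R -> S) n (a b : 'I_n -> R) :
    injective v -> (forall s, v s \in Q) -> (forall x, x \in Q -> v (j x) = x) ->
    (forall s t, v (s + t) = v s + v t) -> (forall s t, v (s * t) = v s * v t) ->
    v 1 = e ->
    (forall x, P x -> E * x = x) -> (forall x, P x -> x * E = x) ->
    \sum_s b s * a s = E -> (forall s t, a s * b t = if s == t then e else 0) ->
    (forall x, x \in Q -> e * x = x) -> (forall x, x \in Q -> x * e = x) ->
    (forall x s t, P x -> a s * x * b t \in Q) ->
    (forall x s t, x \in Q -> P (b s * x * a t)) ->
    (forall x y, P x -> P y -> P (x + y)) -> (forall x y, P x -> P y -> P (x * y)) ->
    P 0 -> P E ->
  let f (x : R) : 'M[S]_n := \matrix_(s, t) j (a s * x * b t) in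
  [/\ forall x y, P x -> P y -> f (x + y) = f x + f y,
      forall x y, P x -> P y -> f (x * y) = f x * f y,
      f E = 1,
      forall x y, P x -> P y -> f x = f y -> x = y &
      forall r, exists2 x, P x & f x = r].
Proof.
move=> v_inj Qv jK vD vM v1 EP PE sumba ab eQ Qe PQ QP PD PM P0 PE1 f.
have v0 : v 0 = 0 by apply: (addIr (v 0)); rewrite -vD !add0r.
have vsum I (r : seq I) (F : I -> S) : v (\sum_(i <- r) F i) = \sum_(i <- r) v (F i).
  by apply: (big_morph v vD v0).
have vf x s t : P x -> v (f x s t) = a s * x * b t by move=> Px; rewrite mxE jK ?PQ.
have fP x (r : 'M[S]_n) : P x -> (forall s t, a s * x * b t = v (r s t)) -> f x = r.
  by move=> Px Dr; apply/matrixP=> s t; apply: v_inj; rewrite vf.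
split=> [x y Px Py|x y Px Py||x y Px Py eqf|r].
- apply: fP => [|s t]; first exact: PD.
  by rewrite mxE vD !vf // mulrDr mulrDl.
- apply: fP => [|s t]; first exact: PM.
  rewrite mxE vsum (eq_bigr (fun k => a s * x * (b k * a k) * (y * b t))); last first.
    by move=> k _; rewrite vM !vf // !mulrA.
  by rewrite -mulr_suml -mulr_sumr sumba -!mulrA [E * _]mulrA EP.
- apply: fP => // s t; rewrite -sumba mulr_sumr mulr_suml (bigD1 s) //= big1 ?addr0.
    by rewrite !mulrA ab eqxx -mulrA ab mxE; case: eqP; rewrite ?v1 ?v0 ?mulr0 ?eQ -?v1.
  by move=> k ks; rewrite !mulrA ab eq_sym (negPf ks) !mul0r.
(* Writing [z] as [E * z * E] and expanding both copies of [E] rebuilds [z] from its matrix entries,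
   whence injectivity. The same expression with arbitrary entries gives the preimages below. *)
- have recover z : P z -> z = \sum_s \sum_t b s * v (f z s t) * a t.
    move=> Pz; have {1}->: z = (\sum_s b s * a s) * z * (\sum_s b s * a s).
      by rewrite sumba EP // PE.
    rewrite -mulrA mulr_suml; apply: eq_bigr => s _.
    by rewrite !mulr_sumr; apply: eq_bigr => t _; rewrite vf // !mulrA.
  by rewrite (recover x) // (recover y) // eqf.
pose x := \sum_s \sum_t b s * v (r s t) * a t.
have Psum (F : 'I_n -> R) : (forall s, P (F s)) -> P (\sum_s F s).
  by move=> PF; elim/big_ind: _ => // *; apply: PD.
have Px : P x by apply: (Psum) => s; apply: Psum => t; apply: QP.
exists x => //; apply: fP => // s t.
rewrite mulr_sumr mulr_suml (bigD1 s) //= [X in _ + X]big1 ?addr0.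
  rewrite mulr_sumr mulr_suml (bigD1 t) //= big1 ?addr0.
    by rewrite !mulrA ab eqxx -mulrA ab eqxx eQ // Qe.
  by move=> k kt; rewrite !mulrA -mulrA [a k * _]ab (negPf kt) mulr0.
move=> k ks; rewrite mulr_sumr mulr_suml big1 // => l _.
by rewrite !mulrA ab eq_sym (negPf ks) !mul0r.
Qed.

(** Coefficientwise this is the formula for an induced character. The factor [#|M|] remains after
    the index in the induced degree is cancelled against [#|L|]. *)
Lemma sum_cidem (gT : finGroupType) (M L : {group gT}) (chi : 'CF(M)) : M \subset L ->
  \sum_(y in L) gv y^-1%g * cidem chi * gv y = #|M|%:R *: cidem ('Ind[L] chi).
Proof.
move=> sML; apply/ffunP=> x; rewrite galg_sumE galg_scaleE cidemE cfInd1 // cfIndE //.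
rewrite (reindex_inj invg_inj) /=.
under eq_bigl => y do rewrite groupV.
under eq_bigr => y _ do rewrite gv_mulr gv_mull !invgK cidemE !invMg invgK -mulgA -conjgE.
rewrite -big_distrr /= -(Lagrange sML) natrM.
have := neq0CG M; have: (#|L : M|%g%:R : algC) != 0 by rewrite pnatr_eq0 -lt0n.
set m := #|M|%:R; set k := #|L : M|%g%:R => k0 m0.
by set S := \sum_(i in L) _; field; rewrite k0 m0.
Qed.

(** * One step of the tower: from the inertia group [M] up to [L] *)

Section InertiaStep.
Variables (gT : finGroupType) (L A : {group gT}) (phi : 'CF(A)).
Let M := 'I_L[phi]%G.
Variable psi : 'CF(M).
Hypotheses (nsAL : (A <| L)%g) (lin_phi : phi \is a linear_char).
Hypotheses (irr_psi : psi \in irr M) (resA : 'Res[A] psi = psi 1%g *: phi).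
Hypothesis irr_ind : 'Ind[L] psi \in irr L.
Let e := qidem psi.
Let C := [set h in L | gmul (gel h) (eQ psi) == gmul (eQ psi) (gel h)].

Lemma mem_centralizer h : reflect (h \in L /\ gv h * e = e * gv h) (h \in C).
Proof. by rewrite inE; apply: (iffP andP) => [[-> /eqP]|[-> /eqP]]. Qed.

Lemma centralizer_group_set : group_set C.
Proof.
apply/group_setP; split=> [|g h]; first by apply/mem_centralizer; rewrite gv1 mul1r mulr1.
move=> /mem_centralizer[Lg eg] /mem_centralizer[Lh eh]; apply/mem_centralizer.
by rewrite groupM // gvM -mulrA eh mulrA eg mulrA.
Qed.
Let Cg := Group centralizer_group_set.

Lemma sub_centralizer : M \subset C.
Proof.
apply/subsetP=> h Mh; apply/mem_centralizer; split; last exact: qidem_gvC.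
by case/setIP: Mh.
Qed.

(** One direction is [qidem_stab]. Conversely, for [h] in [C] the product is [h * e], which is
    nonzero because [h] is invertible. *)
Lemma qidem_gv_neq0 h : h \in L -> (e * gv h * e != 0) = (h \in C).
Proof.
move=> Lh; apply/idP/mem_centralizer=> [nz | [_ <-]].
  by have [] := qidem_stab nsAL lin_phi irr_psi resA Lh nz.
rewrite -mulrA qidem_idem //; apply: contraNneq (qidem_neq0 irr_psi) => he0.
by rewrite -[qidem psi]mul1r -(gvKV h) -mulrA he0 mulr0.
Qed.

Lemma normal_centralizer : (M <| C)%g.
Proof.
rewrite /normal sub_centralizer; apply/subsetP=> h Ch.
have /mem_centralizer[Lh _] := Ch; rewrite -qidem_gv_neq0 // in Ch.
by have [] := qidem_stab nsAL lin_phi irr_psi resA Lh Ch.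
Qed.

Let k := #|L : C|%g.
Let t (s : 'I_k) : gT := repr (enum_val s).
(** Here [b s * a s] is the conjugate of [e] by [t s], and [a s], [b s] pass between this conjugate
    and [e]. *)
Let a s : galgr gT := e * gv (t s).
Let b s : galgr gT := gv (t s)^-1%g * e.

Lemma rcoset_reprL s : t s \in L /\ enum_val s = (C :* t s)%g.
Proof.
have /rcosetsP[x Lx Dx] := enum_valP s; rewrite /t Dx.
have := mem_repr_rcoset Cg x => Cx; split; last exact/esym/(@rcoset_repr _ Cg).
by case/rcosetP: Cx => c /mem_centralizer[Lc _] ->; rewrite groupM.
Qed.

(** The product is [e * gv (t s * (t r)^-1) * e], which vanishes unless the group element lies in
    [C], that is, unless both representatives lie in the same right coset. *)
Lemma matrix_unitsM s r : a s * b r = if s == r then e else 0.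
Proof.
have [[Ls Ds] [Lr Dr]] := (rcoset_reprL s, rcoset_reprL r).
rewrite /a /b -mulrA [_ * (_ * e)]mulrA -gvM mulrA; case: eqP => [-> | nsr].
  by rewrite mulgV gv1 mulr1 qidem_idem.
have Lsr : (t s * (t r)^-1)%g \in L by rewrite groupM ?groupV.
apply/eqP; rewrite -[_ == 0]negbK qidem_gv_neq0 //; apply/negP=> Csr; case: nsr.
by apply: enum_val_inj; rewrite Ds Dr; apply: (@rcoset_eqP _ Cg); rewrite mem_rcoset.
Qed.

Let E := \sum_s b s * a s.

(** The conjugate of [e] by [y] depends only on the coset [C :* y], so the sum over [L] meets each
    conjugate [#|C|] times. *)
Lemma sum_unitsE : #|C|%:R *: E = \sum_(y in L) gv y^-1%g * e * gv y.
Proof.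
have sCL : Cg \subset L by apply/subsetP=> h /mem_centralizer[].
rewrite (set_partition_big _ (rcosets_partition sCL)) /=.
rewrite (eq_bigr (fun X => #|C|%:R *: (gv (repr X)^-1%g * e * gv (repr X)))); last first.
  move=> X /rcosetsP[x Lx ->]; set y := repr _.
  have Dy : (C :* x = C :* y)%g by apply/esym/(@rcoset_repr _ Cg).
  rewrite (eq_bigr (fun _ => gv y^-1%g * e * gv y)) => [|z].
    by rewrite sumr_const (card_rcoset Cg) scaler_nat.
  rewrite Dy => /rcosetP[c /mem_centralizer[_ ce] ->].
  by rewrite invMg !gvM -!mulrA [e * (_ * _)]mulrA -ce !mulrA -[_ * _ * gv c]mulrA gvKV mulr1.
rewrite big_enum_val -scaler_sumr; congr (_ *: _); apply: eq_bigr => s _.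
by rewrite /b /a -!mulrA [e * (e * _)]mulrA qidem_idem.
Qed.

Lemma inQG_units s : inQG L (a s) /\ inQG L (b s).
Proof.
have [Ls _] := rcoset_reprL s.
have eL : inQG L e by apply: inQG_sub (inQG_qidem irr_psi); apply: subsetIl.
by split; apply: inQGM; rewrite ?inQG_gv ?groupV.
Qed.

(* [E] is [r] times a sum, with multiplicities, of the idempotents of the
   Galois conjugates of ['Ind psi]; as [E] is idempotent, each total coefficient is 1. *)
Lemma qidem_Ind : E = qidem ('Ind[L] psi).
Proof.
set chi := 'Ind[L] psi.
have QE : inQG L E by apply: inQG_sum => s _; have [? ?] := inQG_units s; apply: inQGM.
have EE : E * E = E.
  rewrite {1}/E mulr_suml; apply: eq_bigr => s _; rewrite mulr_sumr (bigD1 s) //=.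
  have assoc r : b s * a s * (b r * a r) = b s * (a s * b r) * a r by rewrite !mulrA.
  rewrite big1 ?addr0 => [|r rs]; rewrite assoc matrix_unitsM.
    by rewrite eqxx /b -[_ * e * e]mulrA qidem_idem.
  by rewrite eq_sym (negPf rs) mulr0 mul0r.
(* The constant [r] is [#|M| / #|C|]: the sum of the conjugates of [e] over [L] is [#|C|] times [E]
   by [sum_unitsE], and by [sum_cidem] it is [#|M|] times the sum on the right. *)
have [r r0 DE] : exists2 r : algC, r != 0 & E = r *: \sum_(psi1 <- conjs psi) cidem ('Ind[L] psi1).
  exists (#|C|%:R^-1 * #|M|%:R).
    by rewrite mulf_neq0 ?invr_eq0 ?(neq0CG Cg) ?neq0CG.
  rewrite -scalerA scaler_sumr.
  apply: (can_inj (scalerK (neq0CG Cg))); rewrite sum_unitsE.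
  rewrite scalerA divff ?neq0CG // scale1r.
  rewrite (eq_bigr _ (fun psi1 _ => esym (sum_cidem psi1 (subsetIl L _)))).
  rewrite exchange_big; apply: eq_bigr => y _.
  by rewrite /e qidemE // mulr_sumr mulr_suml.
have Cind psi1 : psi1 \in conjs psi -> 'Ind[L] psi1 \in conjs chi.
  case/(mem_conjs irr_psi)=> u ->; apply/(mem_conjs irr_ind); exists u.
  by rewrite cfAutInd.
have qE : qidem chi * E = E.
  rewrite DE -scalerAr mulr_sumr; congr (_ *: _); rewrite !big_seq.
  by apply: eq_bigr => p /Cind Cp; rewrite qidem_cidem ?Cp // (conjs_irr irr_ind).
rewrite -qE -qidem_comm // {2}qidemE // {1}qidemE // mulr_sumr !big_seq.
apply/esym; apply: eq_bigr => chi1 Cchi1; have irr_chi1 := conjs_irr irr_ind Cchi1.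
(* The multiplicity [m] counts the conjugates of [psi] that induce to [chi1]. It is positive because
   induction commutes with Galois conjugation. *)
have [m m_gt0 Em] : exists2 m : nat, (0 < m)%N & E * cidem chi1 = (r * m%:R) *: cidem chi1.
  exists (count (fun p => 'Ind[L] p == chi1) (conjs psi)).
    rewrite -has_count; apply/hasP; have /(mem_conjs irr_ind)[u ->] := Cchi1.
    by exists (cfAut u psi); rewrite ?cfAutInd //; apply/(mem_conjs irr_psi); exists u.
  rewrite DE -scalerAl mulr_suml -scalerA scaler_nat; congr (_ *: _).
  rewrite -iter_addr_0 -big_const_seq [RHS]big_mkcond !big_seq; apply: eq_bigr => p /Cind Cp.
  by rewrite cidem_irrM ?(conjs_irr irr_ind Cp) //; case: eqP => // ->.
have r_m : r * m%:R != 0 by rewrite mulf_neq0 // pnatr_eq0 -lt0n.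
have: E * (E * cidem chi1) = E * cidem chi1 by rewrite mulrA EE.
rewrite [X in E * X = _]Em -scalerAr [X in _ = X]Em => eqE.
by apply/esym; apply: (can_inj (scalerK r_m)); exact: eqE.
Qed.

(** The corner of the rational group algebra of [L] at [e], described inside that of [C]. Elements
    of [C] commute with [e], so a one-sided condition is enough. *)
Let Q := [pred x : galgr gT | inQG C x && (x * e == x)].

Lemma centralizer_comm (x : galgr gT) : inQG C x -> x * e = e * x.
Proof. by apply: inQG_comm => h /mem_centralizer[]. Qed.

Lemma inQ_idem : e \in Q.
Proof.
by rewrite inE qidem_idem // eqxx (inQG_sub sub_centralizer) //; apply: inQG_qidem.
Qed.

(** Group elements of [L] outside [C] disappear between two copies of [e]. *)
Lemma inQG_corner (y : galgr gT) : inQG L y -> inQG C (e * y * e).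
Proof.
move=> /inQGP[y0 yQ]; rewrite [y]galg_sum_gv mulr_sumr mulr_suml; apply: inQG_sum => h _.
have [Lh | /y0->] := boolP (h \in L); last by rewrite scale0r mulr0 mul0r inQG0.
rewrite -scalerAr -scalerAl; apply: inQGZ => //.
have := qidem_gv_neq0 Lh; have [Ch _ | _ /negbFE/eqP->] := boolP (h \in C); last exact: inQG0.
have /andP[eC _] := inQ_idem.
have hC := inQG_gv Ch.
by apply: (@inQGM _ Cg) => //; apply: (@inQGM _ Cg).
Qed.

(** * The corner ring as a crossed product of [C / M] *)

Section CrossedProduct.
Variable rep : coset_of M -> gT.
Hypothesis repP : forall q, q \in (C / M)%g -> rep q \in C /\ coset M (rep q) = q.

Lemma coset_repM x q : x \in C -> q \in (C / M)%g ->
  (x * (rep q)^-1 \in M)%g = (coset M x == q).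
Proof.
move=> Cx Cq; have [Crq {2}<-] := repP Cq.
have nMC := subsetP (normal_norm normal_centralizer).
rewrite -mem_rcoset; apply/(rcoset_kercosetP (nMC _ Cx) (nMC _ Crq))/eqP => //.
Qed.

(** The summands are supported on distinct cosets of [M], so only the one indexed by the coset of
    [x] contributes at [x]. *)
Lemma sum_repE (r : coset_of M -> galgr gT) x :
    (forall q, q \in (C / M)%g -> forall h, h \notin M -> r q h = 0) -> x \in C ->
  (\sum_(q in (C / M)%g) r q * gv (rep q)) x =
  r (coset M x) (x * (rep (coset M x))^-1)%g.
Proof.
move=> r0 Cx; have CxM : coset M x \in (C / M)%g by exact: (@mem_quotient _ M _ Cg Cx).
rewrite galg_sumE (bigD1 (coset M x)) //= gv_mulr big1 ?addr0 // => q /andP[Cq /negPf xq].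
by rewrite gv_mulr r0 // coset_repM // eq_sym xq.
Qed.

Lemma crossed_product_corner (S : nzRingType) (v : S -> galgr gT) (j : galgr gT -> S) :
    injective v -> (forall s, v s \in Q) -> (forall x, x \in Q -> v (j x) = x) ->
    (forall s t, v (s + t) = v s + v t) -> (forall s t, v (s * t) = v s * v t) ->
    v 1 = e ->
  is_crossed_product (QGe M (eQ psi)) (eQ psi) (C / M)%g
    (fun q x => gmul (gmul (gel (rep q)) x) (gel (rep q)^-1%g))
    (fun q q' => gmul (gel (rep q * rep q' * (rep (q * q')%g)^-1)%g) (eQ psi))
    j (fun q => j (gv (rep q) * e)).
Proof.
move=> v_inj Qv jK vD vM v1; pose P (x : galgr gT) := QGe M (eQ psi) x.
have v0 : v 0 = 0 by apply: (addIr (v 0)); rewrite -vD !add0r.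
have vsum I (s : seq I) (p : pred I) (F : I -> S) :
  v (\sum_(i <- s | p i) F i) = \sum_(i <- s | p i) v (F i) by apply: (big_morph v vD v0).
have PP (x : galgr gT) : P x <-> inQG M x /\ x * e = x.
  by apply: QGeP (qidem_idem irr_psi) (inQG_qidem irr_psi).
have PQ (x : galgr gT) : P x -> x \in Q.
  by case/PP=> Mx /eqP xe; rewrite inE xe (inQG_sub sub_centralizer Mx).
have jP (x : galgr gT) : P x -> v (j x) = x by move/PQ/jK.
have PD (x y : galgr gT) : P x -> P y -> P (x + y).
  by move=> /PP[Mx xe] /PP[My ye]; apply/PP; rewrite inQGD // mulrDl xe ye.
have PM (x y : galgr gT) : P x -> P y -> P (x * y).
  by move=> /PP[Mx xe] /PP[My ye]; apply/PP; rewrite inQGM // -mulrA ye.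
have Pe : P e by apply/PP; rewrite inQG_qidem ?qidem_idem.
have eC h : h \in C -> gv h * e = e * gv h by case/mem_centralizer.
have Qu h : h \in C -> gv h * e \in Q.
  move=> Ch; rewrite inE -mulrA qidem_idem // eqxx andbT.
  by apply: (@inQGM _ Cg); [exact: inQG_gv | have /andP[] := inQ_idem].
have vu q : q \in (C / M)%g -> v (j (gv (rep q) * e)) = gv (rep q) * e.
  by case/repP=> Cq _; rewrite jK ?Qu.
have v_sum (r : coset_of M -> galgr gT) : (forall q, q \in (C / M)%g -> P (r q)) ->
    v (\sum_(q in (C / M)%g) j (r q) * j (gv (rep q) * e)) =
    \sum_(q in (C / M)%g) r q * gv (rep q).
  move=> Pr; rewrite vsum; apply: eq_bigr => q Cq; rewrite vM vu // jP; last exact: Pr.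
  have [Crq _] := repP Cq; have /PP[_ re] := Pr q Cq.
  by rewrite eC // mulrA re.
split.
- split=> x y Px Py; apply: v_inj; first by rewrite vD !jP //; apply: PD.
  by rewrite vM !jP //; apply: PM.
- by apply: v_inj; rewrite v1 jP.
- split=> [s | r r' Pr Pr' eq_rr' q Cq].
    (* Cut [v s] down to the coset of [M] containing [rep q] and translate that piece back into
       [M]. *)
    pose part q : galgr gT := [ffun h => if h \in M then v s (h * rep q)%g else 0].
    have partM q : inQG M (part q).
      have /andP[/inQGP[_ sQ] _] := Qv s.
      by apply/inQGP; split=> h; rewrite ffunE; [move/negPf->| case: ifP => _; rewrite ?rpred0].
    have Pr q : q \in (C / M)%g -> P (part q * e) by exists (part q).
    exists (fun q => part q * e) => //; apply: v_inj; rewrite v_sum //.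
    have /andP[/inQGP[s0 sQ] /eqP se] := Qv s; rewrite -{1}se.
    rewrite (eq_bigr (fun q => part q * gv (rep q) * e)); last first.
      by move=> q /repP[Crq _]; rewrite -!mulrA eC.
    rewrite -mulr_suml; congr (_ * e); apply/ffunP=> x.
    have [Cx | notCx] := boolP (x \in C).
      rewrite sum_repE // => [|q _ h /negPf Mh]; last by rewrite ffunE Mh.
      have CxM : coset M x \in (C / M)%g by exact: (@mem_quotient _ M _ Cg Cx).
      by rewrite ffunE coset_repM // eqxx mulgKV.
    rewrite s0 // galg_sumE big1 // => q /repP[Crq _]; rewrite gv_mulr ffunE.
    by case: ifP => // /(subsetP sub_centralizer) Cxr; rewrite mulgKV s0.
  have eqs := congr1 v eq_rr'; rewrite !v_sum // in eqs.
  have r0 p : (forall q, q \in (C / M)%g -> P (p q)) ->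
      forall q, q \in (C / M)%g -> forall h, h \notin M -> p q h = 0.
    by move=> Pp q1 Cq1; have /PP[/inQGP[]] := Pp q1 Cq1.
  (* The coefficient of [r q] at [h] in [M] is read off from the common sum at [h * rep q]. *)
  apply/ffunP=> h; have [Mh | notMh] := boolP (h \in M); last by rewrite !(r0 r, r0 r').
  have [Crq Dq] := repP Cq; have Ch := subsetP sub_centralizer h Mh.
  have Chq : (h * rep q)%g \in C by apply: (@groupM _ Cg).
  have /ffunP/(_ (h * rep q)%g) := eqs; rewrite !sum_repE //; try exact: r0.
  have -> : coset M (h * rep q) = q.
    by apply/eqP; rewrite -coset_repM // mulgK.
  by rewrite mulgK.
- move=> q x Cq Px; have [Crq _] := repP Cq; have /PP[Mx xe] := Px.
  have nMrq := subsetP (normal_norm normal_centralizer) _ Crq.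
  set y := gmul _ _; have Dy : y = gv (rep q) * x * gv (rep q)^-1%g by [].
  have Py : P y.
    apply/PP; split; last first.
      have C'rq : (rep q)^-1%g \in C by rewrite (@groupV _ Cg).
      by rewrite Dy -!mulrA (eC _ C'rq) !mulrA -[gv _ * x * e]mulrA xe.
    have /inQGP[x0 xQ] := Mx; apply/inQGP; rewrite Dy; split=> h; rewrite gv_mulr gv_mull invgK //.
    by move=> notMh; apply: x0; rewrite -conjgE memJ_norm.
  apply: v_inj; rewrite !vM vu // !jP // Dy -!mulrA [gv _^-1%g * _]mulrA gvKV mul1r.
  by rewrite -centralizer_comm ?(inQG_sub sub_centralizer) //.
move=> q q' Cq Cq'; have [[Crq Dq] [Crq' Dq']] := (repP Cq, repP Cq').
have Cqq : (q * q')%g \in (C / M)%g by apply: (@groupM _ (Cg / M)%G).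
have [Crqq _] := repP Cqq; have Crr : (rep q * rep q')%g \in C by apply: (@groupM _ Cg).
set g := (_ * _ * _)%g; set y := gmul _ _; have Dy : y = gv g * e by [].
have nMC := subsetP (normal_norm normal_centralizer).
have Mg : g \in M by rewrite coset_repM // morphM ?nMC //= Dq Dq'.
have Py : P y by exists (gv g); first exact: inQG_gv.
apply: v_inj; rewrite !vM !vu // jP // Dy.
have ueM h h' : h' \in C -> gv h * e * (gv h' * e) = gv (h * h') * e.
  move=> Ch'; rewrite mulrA -[gv h * e * _]mulrA -(eC _ Ch') gvM -!mulrA.
  by rewrite qidem_idem.
by rewrite !ueM // /g mulgKV.
Qed.

(** A single ring [S], the corner at [e], serves both claims: it is the crossed product, and
    [matrix_corner] with the units [a], [b] gives matrices over it. By [qidem_Ind] the sum [E] of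
    the diagonal idempotents is the identity of the source. *)
Lemma inertia_step :
  let e1 := eQ psi in
  let ei := eQ ('Ind[L] psi) in
  let sig q x := gmul (gmul (gel (rep q)) x) (gel (rep q)^-1%g) in
  let tau q q' := gmul (gel (rep q * rep q' * (rep (q * q')%g)^-1)%g) e1 in
  exists (S : nzRingType) (j : galg gT -> S) (u : coset_of M -> S),
    is_crossed_product (QGe M e1) e1 (C / M)%g sig tau j u /\
    exists f : galg gT -> 'M[S]_k, iso_onto (QGe L ei) ei f.
Proof.
have QM x y : x \in Q -> y \in Q -> x * y \in Q.
  move=> /andP[Cx _] /andP[Cy /eqP ye]; rewrite inE -mulrA ye eqxx andbT.
  exact: (@inQGM _ Cg).
have eQl x : x \in Q -> e * x = x.
  by case/andP=> Cx /eqP xe; rewrite -centralizer_comm.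
have eQr x : x \in Q -> x * e = x by case/andP=> _ /eqP.
have QB x y : x \in Q -> y \in Q -> x - y \in Q.
  move=> /andP[Cx /eqP xe] /andP[Cy /eqP ye].
  by rewrite inE mulrBl xe ye eqxx inQGD ?inQGN.
have [S [v [j [v_inj Qv jK [vD vM v1]]]]] :=
  corner_nzRing QB QM inQ_idem (qidem_neq0 irr_psi) eQl eQr.
exists S, j, (fun q => j (gv (rep q) * e)); split.
  exact: (crossed_product_corner v_inj Qv jK vD vM v1).
pose P (x : galgr gT) := QGe L (eQ ('Ind[L] psi)) x.
have PP (x : galgr gT) : P x <-> inQG L x /\ x * E = x.
  by rewrite qidem_Ind; apply: QGeP (qidem_idem irr_ind) (inQG_qidem irr_ind).
have sCL : C \subset L by apply/subsetP=> h /mem_centralizer[].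
have aE s : a s * E = a s.
  rewrite mulr_sumr (bigD1 s) //= big1 => [|i /negPf si].
    by rewrite addr0 mulrA matrix_unitsM eqxx /a mulrA qidem_idem.
  by rewrite mulrA matrix_unitsM eq_sym si mul0r.
have PE x : P x -> x * E = x by case/PP.
have EP x : P x -> E * x = x.
  by case/PP=> Lx xE; rewrite -[RHS]xE qidem_Ind qidem_comm.
have [] := @matrix_corner _ S P Q e E v j k a b v_inj Qv jK vD vM v1 EP PE erefl matrix_unitsM eQl eQr.
- move=> x s r /PP[Lx _]; have [[Ls _] [Lr _]] := (rcoset_reprL s, rcoset_reprL r).
  have ->: a s * x * b r = e * (gv (t s) * x * gv (t r)^-1%g) * e by rewrite /a /b !mulrA.
  rewrite inE -[_ * e * e]mulrA qidem_idem // eqxx andbT; apply: inQG_corner.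
  by rewrite !inQGM ?inQG_gv ?groupV.
- move=> x s r /andP[Cx _]; have [[_ bL] [aL _]] := (inQG_units s, inQG_units r).
  apply/PP; split; last by rewrite -[_ * E]mulrA aE.
  by apply: inQGM aL; apply: inQGM bL _; apply: inQG_sub Cx.
- by move=> x y /PP[Lx xE] /PP[Ly yE]; apply/PP; rewrite mulrDl xE yE inQGD.
- by move=> x y /PP[Lx xE] /PP[Ly yE]; apply/PP; split; [apply: inQGM | rewrite -mulrA yE].
- by apply/PP; rewrite mul0r inQG0.
- by apply/PP; rewrite qidem_Ind qidem_idem ?inQG_qidem.
move=> fD fM f1 f_inj f_onto.
exists (fun x => \matrix_(s, r) j (a s * x * b r)); split=> //.
by rewrite -[eQ _]/(qidem _) -qidem_Ind.
Qed.

End CrossedProduct.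
End InertiaStep.

(** * The leaf: a linear character and its cyclotomic field *)

Section LinearIso.
Variables (gT : finGroupType) (H : {group gT}) (th : 'CF(H)).
Hypothesis lin_th : th \is a linear_char.
Let k := #|H : cfker th|%g.

(** The linear extension of [psi] to the group algebra; [psi] vanishes outside [H]. *)
Definition lin_eval (psi : 'CF(H)) (x : galgr gT) : algC := \sum_g x g * psi g.

Lemma lin_evalD psi (x y : galgr gT) : lin_eval psi (x + y) = lin_eval psi x + lin_eval psi y.
Proof.
by rewrite -big_split; apply: eq_bigr => g _; rewrite galg_addE mulrDl.
Qed.

Lemma lin_evalZ psi c (x : galgr gT) : lin_eval psi (c *: x) = c * lin_eval psi x.
Proof. by rewrite /lin_eval mulr_sumr; apply: eq_bigr => g _; rewrite galg_scaleE mulrA. Qed.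

Lemma lin_eval_gv psi g : lin_eval psi (gv g) = psi g.
Proof.
rewrite /lin_eval (bigD1 g) //= gelE eqxx mul1r big1 ?addr0 // => h /negPf hg.
by rewrite gelE hg mul0r.
Qed.

Lemma lin_eval_cidem psi (x : galgr gT) : psi \is a linear_char -> inQG H x ->
  x * cidem psi = lin_eval psi x *: cidem psi.
Proof.
move=> lin_psi /inQGP[x0 _]; rewrite {1}[x]galg_sum_gv mulr_suml scaler_suml.
apply: eq_bigr => g _; rewrite -scalerAl -scalerA.
have [Hg | /x0->] := boolP (g \in H); last by rewrite !scale0r.
rewrite (central_cidem (phi := psi) (A := H)) ?lin_char_irr //.
by rewrite cfRes_id lin_char1 // scale1r.
Qed.

(** Multiplication by [x] scales the nonzero element [cidem psi] by [lin_eval psi x], and scalars of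
    successive multiplications multiply. *)
Lemma lin_evalM psi (x y : galgr gT) : psi \is a linear_char -> inQG H x -> inQG H y ->
  lin_eval psi (x * y) = lin_eval psi x * lin_eval psi y.
Proof.
move=> lin_psi Hx Hy; have nz := cidem_neq0 (lin_char_irr lin_psi).
have: x * y * cidem psi = lin_eval psi x * lin_eval psi y *: cidem psi.
  by rewrite -mulrA !lin_eval_cidem // -scalerAr lin_eval_cidem // scalerA mulrC.
rewrite lin_eval_cidem ?inQGM // => /eqP.
by rewrite -subr_eq0 -scalerBl scaler_eq0 (negPf nz) orbF subr_eq0 => /eqP.
Qed.

Lemma lin_eval_qidem (x : galgr gT) : inQG H x -> lin_eval th (x * qidem th) = lin_eval th x.
Proof.
move=> Hx; have irr_th := lin_char_irr lin_th.
suffices e1 : lin_eval th (qidem th) = 1 by rewrite lin_evalM ?inQG_qidem // e1 mulr1.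
have := lin_eval_cidem lin_th (inQG_qidem irr_th); rewrite qidem_cidem ?conjs_id //.
rewrite -[X in X = _]scale1r => /eqP; rewrite -subr_eq0 -scalerBl scaler_eq0.
by rewrite (negPf (cidem_neq0 irr_th)) orbF subr_eq0 => /eqP.
Qed.

(* A Galois conjugate of [th] vanishes at a rational [x] as soon as [th] does. *)
Lemma lin_eval_inj (x : galgr gT) : inQG H x -> x * qidem th = x -> lin_eval th x = 0 -> x = 0.
Proof.
move=> Hx <- fx0; have irr_th := lin_char_irr lin_th; rewrite lin_eval_qidem // in fx0.
rewrite qidemE // mulr_sumr big_seq big1 // => psi /(mem_conjs irr_th)[u ->].
rewrite lin_eval_cidem ?cfAut_lin_char //.
suffices ->: lin_eval (cfAut u th) x = u (lin_eval th x) by rewrite fx0 rmorph0 scale0r.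
have /inQGP[_ xQ] := Hx.
rewrite rmorph_sum; apply: eq_bigr => g _.
by rewrite cfunE rmorphM /= (aut_Crat u (xQ g)).
Qed.

Lemma lin_char_root g : g \in H -> th g ^+ k = 1.
Proof.
move=> Hg; rewrite -lin_charX //.
have Kgk : (g ^+ k)%g \in cfker th.
  have nKg := subsetP (normal_norm (cfker_normal th)) g Hg.
  rewrite coset_idr ?groupX // morphX //= /k -card_quotient ?normal_norm ?cfker_normal //.
  by rewrite expg_cardG ?mem_quotient.
by rewrite cfker1 // lin_char1.
Qed.

(** The center of a linear character is all of [H], so the quotient by the kernel is cyclic. A
    preimage of a generator has a value of exact order [k], since a smaller power with value 1 would
    lie in the kernel. *)
Lemma lin_char_prim : exists2 g, g \in H & k.-primitive_root (th g).
Proof.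
have Zth : 'Z(th)%CF = H.
  apply/setP=> g; rewrite /cfcenter lin_charW // inE; case Hg: (g \in H) => //=.
  by rewrite normC_lin_char // lin_char1 ?eqxx.
have := cfcenter_cyclic th; rewrite Zth => /cyclicP[gK DgK].
have : gK \in (H / cfker th)%g by rewrite DgK cycle_id.
case/morphimP=> g nKg Hg Dg; exists g => //.
have ok : #[gK]%g = k by rewrite orderE -DgK card_quotient // normal_norm ?cfker_normal.
have k_gt0 : (0 < k)%N by rewrite -ok order_gt0.
have [m prim_m m_dv_k] := prim_order_exists k_gt0 (lin_char_root Hg).
suffices k_dv_m : (k %| m)%N by have /eqP<- : m == k; rewrite ?eqn_dvd ?m_dv_k.
rewrite -ok order_dvdn Dg -morphX //= ; apply/eqP/coset_id.
rewrite cfkerEchar ?lin_charW // inE groupX //= lin_charX // lin_char1 //.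
by rewrite (prim_expr_order prim_m).
Qed.

Lemma linear_iso xi : k.-primitive_root xi ->
  exists f : galg gT -> algC, iso_onto_sub (QGe H (eQ th)) (eQ th) (Qadj xi) f.
Proof.
move=> prim_xi; have irr_th := lin_char_irr lin_th; pose e := qidem th.
have ee : e * e = e by apply: qidem_idem.
have He : inQG H e by apply: inQG_qidem.
have PP (x : galgr gT) : QGe H (eQ th) x <-> inQG H x /\ x * e = x by apply: QGeP.
exists (lin_eval th); split=> [x y _ _ | x y /PP[Hx _] /PP[Hy _] | | x y | z].
- exact: lin_evalD.
- exact: lin_evalM.
- by rewrite -[eQ th]/e -[e]mul1r lin_eval_qidem ?lin_eval_gv ?lin_char1 // -gv1 inQG_gv.
- move=> /PP[Hx xe] /PP[Hy ye] fxy; apply/eqP; rewrite -subr_eq0; apply/eqP.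
  apply: (@lin_eval_inj (x - y)); first by rewrite inQGD ?inQGN.
    by rewrite mulrBl xe ye.
  by rewrite lin_evalD fxy -lin_evalD subrr -[0](scale0r (1 : galgr gT)) lin_evalZ mul0r.
split=> [[p ->{z}] | [x /PP[Hx _] <-{z}]]; last first.
  rewrite /lin_eval; elim/big_rec: _ => [|g z _ [p ->]].
    by exists 0; rewrite rmorph0 horner0.
  have /inQGP[_ /(_ g)/CratP[c ->]] := Hx.
  have [Hg | notHg] := boolP (g \in H); last by exists p; rewrite cfun0 ?mulr0 ?add0r.
  have [i ->] := prim_rootP prim_xi (lin_char_root Hg).
  by exists (c *: 'X^i + p); rewrite rmorphD /= map_polyZ map_polyXn !hornerE.
have [g Hg prim_g] := lin_char_prim.
(* Since [xi] is the value of [th] at [g ^+ i], replacing the powers of [xi] in the polynomial by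
   powers of this element gives the preimage [a * e]. *)
have [i Dxi] := prim_rootP prim_g (prim_expr_order prim_xi).
pose a : galgr gT := \sum_(m < size p) ratr p`_m *: gv (g ^+ (i * m))%g.
have Ha : inQG H a.
  by apply: inQG_sum => m _; rewrite inQGZ ?Crat_rat ?inQG_gv ?groupX.
exists (a * e); first by exists a.
rewrite lin_eval_qidem // horner_coef size_map_poly.
have f0 : lin_eval th 0 = 0 by rewrite -(scale0r (1 : galgr gT)) lin_evalZ mul0r.
rewrite /a (big_morph _ (lin_evalD th) f0); apply: eq_bigr => m _.
by rewrite lin_evalZ lin_eval_gv coef_map /= Dxi lin_charX // exprM.
Qed.

End LinearIso.

(** * Climbing the path from the leaf to the root *)

Lemma sub_calA (gT : finGroupType) (G N : {group gT}) (v : lintriple gT) (X : {group gT}) :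
  NLT G N v -> calA_spec v X -> tA v \subset X.
Proof.
case: v => L A th [/= _ nsAL lin_th inv_th _] [/=]; set K := cfker th => nsXL sKX abXK maxX.
have [sAL nAL] := andP nsAL; have sXL := normal_sub nsXL.
have nKL : L \subset 'N(K)%g.
  apply/subsetP=> h Lh; have /setIdP[nAh /eqP thh] := subsetP inv_th h Lh.
  by apply/normP; rewrite -(cfker_conjg th nAh) thh.
(* Invariance of [th] under [L] makes [A] central in [L] modulo the kernel [K]. *)
have sALK : [~: A, L]%g \subset K.
  rewrite gen_subG; apply/subsetP=> _ /imset2P[a h Aa Lh ->].
  have Aah : (a ^ h)%g \in A by rewrite memJ_norm ?(subsetP nAL).
  rewrite /K /= cfkerEchar ?lin_charW // inE commgEl groupM ?groupV //=.
  rewrite lin_charM ?groupV // inertia_valJ ?(subsetP inv_th) //.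
  by rewrite -lin_charM ?groupV // mulVg.
have nKA := subset_trans sAL nKL; have nKX := subset_trans sXL nKL.
have sKA : K \subset A by apply: normal_sub (cfker_normal th).
(* As [A] is central modulo [K], the join of [A] and [X] is again normal in [L] and abelian modulo
   [K], so maximality of [#|X|] makes it equal to [X]. *)
suffices /eqP-> : X == (A <*> X)%G by apply: joing_subl.
rewrite -val_eqE eqEcard joing_subr; apply: maxX.
- exact: normalY.
- exact: subset_trans sKA (joing_subl _ _).
rewrite quotientY // abelianY abXK andbC /= /abelian !quotient_cents2 //.
by rewrite commGC !(subset_trans _ sALK) // commgS.
Qed.

(** The three conditions on [w] are an invariant that passes to its parent [v]: Clifford
    correspondence preserves irreducibility on induction from the inertia group. They are also what
    [inertia_step] needs for this edge. *)
Lemma child_step (gT : finGroupType) (G N : {group gT})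
    (calA : lintriple gT -> {group gT}) (reps : forall v, 'CF(calA v) -> Prop)
    (v w : lintriple gT) (B : {group gT}) (th : 'CF(B)) :
    NLT G N v -> calA_spec v (calA v) -> reps_spec G N v (reps v) -> child reps v w ->
    B \subset tH w -> 'Ind[tH w] th \in irr (tH w) ->
    '['Res[tA w] ('Ind[tH w] th), tth w] != 0 ->
  [/\ B \subset tH v, 'Ind[tH v] th \in irr (tH v),
      '['Res[tA v] ('Ind[tH v] th), tth v] != 0 &
    let e1 := eQ ('Ind[tH w] th) in
    let ei := eQ ('Ind[tH v] th) in
    let C := [set h in tH v | gmul (gel h) e1 == gmul e1 (gel h)] in
    let ki := #|tH v : C|%g in
    forall rep : coset_of (tH w) -> gT,
      (forall q, q \in (C / tH w)%g -> rep q \in C /\ coset (tH w) (rep q) = q) ->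
      let sig q x := gmul (gmul (gel (rep q)) x) (gel (rep q)^-1%g) in
      let tau q q' := gmul (gel (rep q * rep q' * (rep (q * q')%g)^-1)%g) e1 in
      exists (S : nzRingType) (j : galg gT -> S) (u : coset_of (tH w) -> S),
        is_crossed_product (QGe (tH w) e1) e1 (C / tH w)%g sig tau j u /\
        exists f : galg gT -> 'M[S]_ki, iso_onto (QGe (tH v) ei) ei f].
Proof.
move=> NLTv calAv repsv [_ [phi repsphi ->]] /= sBM irr_psi psi_phi.
have [lin_phi resv _] := repsv.1 _ repsphi; have [_ _ lin_thv _ _] := NLTv.
have sAA := sub_calA NLTv calAv; have [nsAL _ _ _] := calAv.
move: (calA v) {repsv} phi {repsphi} lin_phi resv sAA nsAL {calAv} sBM irr_psi psi_phi.
move: (tH v) => L A phi lin_phi resv sAA nsAL.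
have /irrP[t Dphi] := lin_char_irr lin_phi; subst phi.
set M := 'I_L['chi_t]%G => sBM irr_psi psi_phi.
have sML : M \subset L := subsetIl _ _; have sAM : A \subset M := sub_Inertia_base 'chi_t nsAL.
have nsAM : (A <| M)%g := normalS sAM sML nsAL.
have <-: 'Ind[L] ('Ind[M] th) = 'Ind[L] th by rewrite cfIndInd.
move: ('Ind[M] th) irr_psi psi_phi => psi irr_psi psi_phi.
have /irrP[s Dpsi] := irr_psi.
have Ast : t \in irr_constt ('Res[A] 'chi_s) by rewrite irr_consttE -Dpsi.
(* The inertia group [M] fixes ['chi_t], so the Clifford sum over its conjugates has a single
   term. *)
have resA : 'Res[A] psi = psi 1%g *: 'chi_t.
  have := Clifford_Res_sum_cfclass nsAM Ast; rewrite -Dpsi cfclass_invariant ?subsetIr //.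
  rewrite big_seq1 => Dres; rewrite Dres; congr (_ *: _).
  by have /cfunP/(_ 1%g) := Dres; rewrite cfRes1 cfunE (lin_char1 lin_phi) mulr1.
have [irr_ind phi_ind] :
    'Ind[L] psi \in irr L /\ '['Res[A] ('Ind[L] psi), 'chi_t] != 0.
  have [indA _ _ _ resd] := constt_Inertia_bijection t nsAL.
  have Is : s \in irr_constt ('Ind[M] 'chi_t) by rewrite constt_Ind_Res.
  by rewrite Dpsi -resd // -Dpsi; split=> //; rewrite Dpsi; apply: indA.
split=> //; first exact: subset_trans sBM sML.
  (* The induced character lies over ['chi_t], which in turn lies over [tth v] by the choice of the
     representatives; constituents of restrictions are transitive. *)
  have NresA : 'Res[A] ('Ind[L] psi) \is a character by rewrite cfRes_char ?irrWchar.
  have /irrP[r Dr] := lin_char_irr lin_thv.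
  have ltA : r \in irr_constt ('Res[tA v] 'chi_t) by rewrite irr_consttE -Dr.
  have := constt_Res_trans NresA _ ltA.
  by rewrite !irr_consttE Dr cfResRes ?(normal_sub nsAL) //; apply.
exact: (inertia_step nsAL lin_phi irr_psi resA irr_ind).
Qed.

Theorem theorem5 (gT : finGroupType) (G N : {group gT})
  (calA : lintriple gT -> {group gT}) (reps : forall v, 'CF(calA v) -> Prop)
  (p : seq (lintriple gT)) :
  classC G -> (N <| G)%g ->
  (forall v, NLT G N v -> calA_spec v (calA v) /\ reps_spec G N v (reps v)) ->
  leaf_path G N reps p ->
  let n := size p in
  let lf := last (root_triple G N) p in
  let H := tA lf in
  let th := tth lf in
  let K := cfker th in
  let k := #|H : K|%g in
  let Hi (i : nat) : {group gT} := tH (nth (root_triple G N) p i) in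
  forall xi : algC, k.-primitive_root xi ->
  (exists f : galg gT -> algC, iso_onto_sub (QGe H (eQ th)) (eQ th) (Qadj xi) f) /\
  (forall i : nat, (i.+1 < n)%N ->
    let e1 := eQ ('Ind[Hi i.+1] th) in
    let ei := eQ ('Ind[Hi i] th) in
    let C := [set h in Hi i | gmul (gel h) e1 == gmul e1 (gel h)] in
    let ki := #|Hi i : C|%g in
    forall rep : coset_of (Hi i.+1) -> gT,
      (forall q, q \in (C / Hi i.+1)%g ->
         rep q \in C /\ coset (Hi i.+1) (rep q) = q) ->
      let sig q x := gmul (gmul (gel (rep q)) x) (gel (rep q)^-1%g) in
      let tau q q' := gmul (gel (rep q * rep q' * (rep (q * q')%g)^-1)%g) e1 in
      exists (S : nzRingType) (j : galg gT -> S) (u : coset_of (Hi i.+1) -> S),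
        is_crossed_product (QGe (Hi i.+1) e1) e1 (C / Hi i.+1)%g sig tau j u /\
        exists f : galg gT -> 'M[S]_ki, iso_onto (QGe (Hi i) ei) ei f).
Proof.
move=> _ _ specs [p_gt0 _ NLTp childp leafH] n lf H th K k Hi xi prim_xi.
have lfE : lf = nth (root_triple G N) p n.-1 by rewrite /lf -nth_last.
have NLTlf : NLT G N lf by rewrite lfE; apply: NLTp; rewrite prednK.
have [_ _ lin_th _ _] := NLTlf.
split; first exact: linear_iso.
(* The invariant of [child_step] at node [i]. Nodes are numbered from 0, so the leaf is node
   [n.-1]. *)
pose good i := [/\ H \subset Hi i, 'Ind[Hi i] th \in irr (Hi i) &
  '['Res[tA (nth (root_triple G N) p i)] ('Ind[Hi i] th),
    tth (nth (root_triple G N) p i)] != 0].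
(* At the leaf both groups of the triple coincide, so induction and restriction are trivial and [th]
   has norm 1. *)
have good_leaf : good n.-1.
  rewrite /good /Hi -lfE /th /H; have irr_th := lin_char_irr lin_th.
  move: leafH irr_th; rewrite -/lf /th; case: (lf) => L A tht /= <- irr_th.
  by rewrite cfInd_id cfRes_id irrWnorm ?oner_eq0.
have step i lt_i := fun g : good i.+1 => let: And3 sH irr_i res_i := g in
  child_step (NLTp i (ltnW lt_i)) (specs _ (NLTp i (ltnW lt_i))).1
    (specs _ (NLTp i (ltnW lt_i))).2 (childp i lt_i) sH irr_i res_i.
(* Induction on the distance [d] from the leaf, as the invariant travels towards the root. *)
have all_good d : (d < n)%N -> good (n.-1 - d)%N.
  elim: d => [|d IHd] lt_d; first by rewrite subn0.
  have Dd : (n.-1 - d = (n.-1 - d.+1).+1)%N by rewrite subnSK // -ltnS prednK.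
  have lt_i : ((n.-1 - d.+1).+1 < n)%N by rewrite -Dd -[X in (_ < X)%N](prednK p_gt0) ltnS leq_subr.
  by have := IHd (ltnW lt_d); rewrite Dd => /(step _ lt_i)[].
move=> i lt_i; have good_i : good i.+1.
  have := all_good (n.-1 - i.+1)%N; rewrite subKn; last by rewrite -ltnS prednK.
  by apply; apply: leq_ltn_trans (leq_subr _ _) _; rewrite prednK.
by have [] := step i lt_i good_i.
Qed.
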